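(* Let $X$ be a compact convex set equipped with a proximal setup (norm $\|\cdot\|$, distance-generating function $\omega$, Bregman distance $V$, prox-mapping $\mathrm{Prox}$, $\omega$-center $x_\omega$, set width $\Omega$), with $\max_{x,x'\in X}\|x-x'\|\le D<\infty$. Let $f:X\times U\to\mathbb{R}$ be such that, for every $u\in U$, $f(\cdot,u)$ is convex, $\|\nabla_xf(x,u)\|_*\le G_{f,X}$ for all $x\in X$, and $f(x,u)-\alpha_{f,X}\,\omega(x)$ is convex in $x$, or equivalently $f(x,u)\le f(x',u)+\langle\nabla_xf(x,u),x-x'\rangle-\alpha_{f,X}V_x(x')$ for all $x,x'\in X$, where $G_{f,X}>0$ and $\alpha_{f,X}>0$ are independent of $u$. Let $u_1,u_2,\dots$ be points of $U$. Set $x_1:=x_\omega$ and $$x_{t+1}:=\mathrm{Prox}_{x_t}(\gamma_t\nabla_xf(x_t,u_t)),\qquad\gamma_t=\frac{2}{\alpha_{f,X}(t+1)},$$ and define $q_t(x)=\langle\nabla_xf(x_t,u_t),x\rangle+\alpha_{f,X}V_{x_t}(x)$. For $T\ge1$ let $\theta_t=\frac{2t}{T(T+1)}$, $t\in[T]$. Then $$\sum_{t=1}^T\theta_tq_t(x_t)-\inf_{x\in X}\sum_{t=1}^T\theta_tq_t(x)\ \le\ \frac{2G_{f,X}^2}{\alpha_{f,X}(T+1)}=O\!\left(\frac1T\right).$$ Furthermore, let $u^*\in\arg\min_{u\in U}g(u)$, where $g$ is strongly convex and smooth in $u$, and suppose there exist $G_{f,U}>0$ and $L_{f,U}>0$ such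 that for all $u,u'\in U$ and $x\in X$, $$|f(x,u)-f(x,u')|\le G_{f,U}\|u-u'\|,\qquad\|\nabla_xf(x,u)-\nabla_xf(x,u')\|_*\le L_{f,U}\|u-u'\|,$$ and that $\|u_t-u^*\|=O(\beta^t)$ for some $0<\beta<1$. Define $\bar x_T=\sum_{t=1}^T\theta_tx_t$. Then $$\left|f(\bar x_T,u_T)-\min_{x\in X}f(x,u^* )\right|=O\!\left(\frac1T\right)+o\!\left(\frac1T\right).$$
   Context: $[T]=\{1,\dots,T\}$. $\nabla_xf(x,u)$ is a (selected) subgradient at $x$ of $f(\cdot,u)$. $U$ is the domain of the data $u$, carrying a norm also written $\|\cdot\|$. Proximal setup for a convex domain $Z$ in a Euclidean space $E$ (here $Z=X$): (i) a norm $\|\cdot\|$ on $E$ with dual norm $\|\zeta\|_*=\max_{\|z\|\le 1}\langle\zeta,z\rangle$; (ii) a distance-generating function $\omega:Z\to\mathbb{R}$, convex and continuous on $Z$, admitting a selection of subgradients $\nabla\omega(z)$ that is continuous on $Z^\circ:=\{z\in Z:\partial\omega(z)\ne\emptyset\}$, and strongly convex with modulus 1: $\langle\nabla\omega(z')-\nabla\omega(z''),z'-z''\rangle\ge\|z'-z''\|^2$ for all $z',z''\in Z^\circ$; (iii) Bregman distance $V_z(z'):=\omega(z')-\omega(z)-\langle\nabla\omega(z),z'-z\rangle$ for $z\in Z^\circ$, $z'\in Z$; (iv) prox-mapping $\mathrm{Prox}_z(\xi):=\arg\min_{z'\in Z}\{\langle\xi,z'\rangle+V_z(z')\}$, a map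 $E\to Z^\circ$, for $z\in Z^\circ$; (v) $\omega$-center $z_\omega:=\arg\min_{z\in Z}\omega(z)$; (vi) set width $\Omega:=\max_{z\in Z}V_{z_\omega}(z)$. Existence of these minimizers and of the maximum is part of the setup. *)

(* Defs.v *)
(* The Euclidean space is 'rV[R]_n with its standard inner product; the data
   u live in an arbitrary normed space W.
   Functions on a set Z (resp. X, U) are total functions of which only the
   values on Z (resp. X, U) are ever constrained or used. *)
From mathcomp Require Import all_boot all_order all_algebra.
From mathcomp Require Import all_classical all_reals all_analysis.
Set Implicit Arguments.
Unset Strict Implicit.
Unset Printing Implicit Defensive.
Import Order.TTheory GRing.Theory Num.Theory.
Import numFieldNormedType.Exports.
Local Open Scope classical_set_scope.
Local Open Scope ring_scope.

Section Optimization.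
Context {R : realType} {T : Type}.
Implicit Types (A : set T) (F : T -> R).

Definition minimizers A F : set T :=
  [set z | A z /\ forall y, A y -> F z <= F y].

Definition is_minimum A F (m : R) := (F @` A) m /\ lbound (F @` A) m.

Definition is_maximum A F (m : R) := (F @` A) m /\ ubound (F @` A) m.

End Optimization.

(* Some minimizer; the default point of T when there is none. *)
Definition argmin {R : realType} {T : pointedType} (A : set T) (F : T -> R) : T :=
  get (minimizers A F).

Section Proximal.
Context {R : realType} {n : nat}.
Local Notation E := 'rV[R]_n.
Implicit Types (x y z xi zeta : E) (Z : set E).

Definition dot x y : R := \sum_(i < n) x 0 i * y 0 i.

Definition is_norm (N : E -> R) :=
  [/\ forall x y, N (x + y) <= N x + N y,
      forall (a : R) x, N (a *: x) = `|a| * N x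
    & forall x, N x = 0 -> x = 0].

Definition dual_norm (N : E -> R) zeta : R :=
  sup [set dot zeta z | z in [set z | N z <= 1]].

(* For z in Z: the subdifferential at z of h : Z -> R, extended by +oo
   outside Z (so on the boundary it absorbs the normal cone of Z). *)
Definition subdifferential Z (h : E -> R) z : set E :=
  [set zeta | forall y, Z y -> h z + dot zeta (y - z) <= h y].

(* The set Z° *)
Definition dom_subdiff Z (h : E -> R) : set E :=
  [set z | Z z /\ subdifferential Z h z !=set0].

Definition bregman (omega : E -> R) (domega : E -> E) z y : R :=
  omega y - omega z - dot (domega z) (y - z).

Definition prox Z (omega : E -> R) (domega : E -> E) z xi : E :=
  argmin Z (fun y => dot xi y + bregman omega domega z y).

Definition omega_center Z (omega : E -> R) : E := argmin Z omega.

(* N is the norm, omega the distance-generating function, domega its selected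
   subgradient and Omega the set width. *)
Record proximal_setup Z (N : E -> R) (omega : E -> R) (domega : E -> E)
    (Omega : R) : Prop := ProximalSetup {
  ps_norm : is_norm N ;
  ps_convex : convex_function Z omega ;
  ps_continuous : {within Z, continuous omega} ;
  ps_subgradient : forall z, dom_subdiff Z omega z ->
    subdifferential Z omega z (domega z) ;
  ps_grad_continuous : {within dom_subdiff Z omega, continuous domega} ;
  ps_strongly_convex : forall z z',
    dom_subdiff Z omega z -> dom_subdiff Z omega z' ->
    N (z - z') ^+ 2 <= dot (domega z - domega z') (z - z') ;
  ps_prox_ex : forall z xi, dom_subdiff Z omega z ->
    minimizers Z (fun y => dot xi y + bregman omega domega z y) !=set0 ;
  ps_center_ex : minimizers Z omega !=set0 ;
  ps_width : is_maximum Z (bregman omega domega (omega_center Z omega)) Omega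
}.

End Proximal.

Section DataSpace.
Context {R : realType} {W : normedModType R}.
Implicit Types (U : set W) (g : W -> R).

Definition strongly_convex_on U g (mu : R) :=
  convex_set U /\
  forall (u v : W) (l : R), U u -> U v -> 0 <= l <= 1 ->
    g (l *: u + (1 - l) *: v) <=
      l * g u + (1 - l) * g v - mu / 2 * l * (1 - l) * `|u - v| ^+ 2.

(* g is differentiable relatively to U, with an L-Lipschitz derivative;
   the last clause bounds the operator norm of dg u - dg v. *)
Definition smooth_on U g (L : R) :=
  exists dg : W -> {linear W -> R^o},
    (forall u, U u -> continuous (dg u) /\
       (fun v => g v - g u - dg u (v - u) : R^o)
         =o_ (within U (nbhs u)) (fun v => v - u)) /\
    (forall (u v h : W), U u -> U v ->
       `|dg u h - dg v h| <= L * `|u - v| * `|h|).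

End DataSpace.

Section Weights.
Context {R : realType}.

Definition step_size (alpha : R) (t : nat) : R := 2 / (alpha * t.+1%:R).

Definition theta (T t : nat) : R := 2 * t%:R / (T%:R * T.+1%:R).

End Weights.

(* Main.v *)
Require Import Defs.
From mathcomp Require Import all_boot all_order all_algebra.
From mathcomp Require Import all_classical all_reals all_analysis.
From mathcomp Require Import ring lra.
Set Implicit Arguments.
Unset Strict Implicit.
Unset Printing Implicit Defensive.
Import Order.TTheory GRing.Theory Num.Theory.
Import numFieldNormedType.Exports.
Local Open Scope classical_set_scope.
Local Open Scope ring_scope.

(** The first claim is the usual mirror descent regret bound with step sizes
    adapted to relative strong convexity.  For a prox step from [x t] with
    linear term [gamma *: g], optimality at [x t.+1], the identity relating
    three Bregman distances, and [N (x t.+1 - x t) ^+ 2 / 2 <= V] give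

      gamma <g, x_t - y> <= V_{x_t}(y) - V_{x_{t+1}}(y) + gamma^2 G^2 / 2

    ([prox_descent]).  With gamma_t = 2 / (alpha (t+1)), subtracting
    alpha V_{x_t}(y) and multiplying by t makes the Bregman terms telescope, and
    each of the T residues is at most G^2 / alpha ([theta_telescope],
    [mirror_descent_regret]).

    For the second claim, let y minimise f(., ustar).  Relative strong convexity
    bounds f(x_t, u_t) - f(y, u_t) by q_t(x_t) - q_t(y), Jensen's inequality
    passes to the weighted mean, and replacing u_t by ustar costs
    2 GU |u_t - ustar| per term.  Since |u_t - ustar| = O(beta^t) and
    theta_t <= 2 / T, these errors sum to O(1/T), and the last one,
    GU |u_T - ustar|, is O(1/T) as well.

    Turning the definitions of the proximal setup into these inequalities takes
    some care, because the set Z° of points where omega has a subgradient need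
    not be convex and the selection domega may blow up at its edge.  Classical
    accounts work in the relative interior of X.  Here instead every p in X is
    approximated by minimisers w of omega + M |. - p|^2: such a w lies in Z°,
    tends to p as M grows, and carries the subgradient 2 M (p - w), which has
    nonnegative inner product with p - w ([near_subgradient]).  Together with
    the continuity of domega on Z°, this shows that the directional derivative
    of omega at z in Z° towards y is at most <domega z, y - z>
    ([directional_derivative_le]), hence that domega z dominates every other
    subgradient in feasible directions ([domega_maximal]).  Prox-optimality in
    terms of the selected subgradient, the inequality
    N (y - z) ^+ 2 / 2 <= V_z(y), and the gradient form of relative strong
    convexity all follow from these facts. *)

(** * Passing to the limit in perturbed inequalities *)

Section RealLimits.
Context {R : realType}.
Implicit Types a b d e : R.

Lemma ge0_perturb a b :
  (forall d, 0 < d -> d <= 1 -> 0 <= a + b * d) -> 0 <= a.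
Proof.
move=> H; rewrite leNgt; apply/negP => a0.
have b0 : 0 < `|b| + 1 by rewrite ltr_wpDl.
pose d := Num.min 1 (- a / (2 * (`|b| + 1))).
have d0 : 0 < d.
  by rewrite lt_min ltr01 divr_gt0 ?oppr_gt0// mulr_gt0.
have d1 : d <= 1 by rewrite ge_min lexx.
have db : d * (`|b| + 1) <= - a / 2.
  by rewrite -ler_pdivlMr// ge_min invfM mulrA lexx orbT.
have := H d d0 d1; have := ler_norm b; nra.
Qed.

Lemma ge0_perturb_harmonic a b :
  (forall k : nat, 0 <= a + b / k.+1%:R) -> 0 <= a.
Proof.
move=> H; apply: (@ge0_perturb a `|b|) => d d0 _.
have [k kd] : exists k : nat, k.+1%:R^-1 < d.
  exists (Num.bound d^-1); rewrite invf_plt ?posrE//.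
  rewrite (lt_trans (archi_boundP _)) ?ltr_nat// ltW ?invr_gt0//.
apply: le_trans (H k) _; rewrite lerD2l.
rewrite (le_trans (ler_wpM2r _ (ler_norm b)))//.
by rewrite ler_wpM2l// ltW.
Qed.

End RealLimits.

(** * Continuity relative to a set *)

Section Continuity.
Context {R : realType} {V W : normedModType R}.

Lemma within_continuous_dist (A : set V) (h : V -> W) :
  {within A, continuous h} -> forall z, A z -> forall e : R, 0 < e ->
  exists2 d : R, 0 < d & forall w, A w -> `|w - z| < d -> `|h w - h z| < e.
Proof.
move=> /subspace_continuousP ch z Az e e0.
have /cvgrPdist_lt/(_ e e0) := ch z Az.
rewrite near_withinE => /nbhs_normP[d /= d0 H].
exists d => // w Aw wz; rewrite distrC; apply: H => //=.
by rewrite distrC.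
Qed.

Lemma lipschitz_within_continuous (A : set V) (h : V -> W) (c : R) :
  (forall y z, A y -> A z -> `|h y - h z| <= c * `|y - z|) ->
  {within A, continuous h}.
Proof.
move=> H; apply/subspace_continuousP => z Az.
apply/cvgrPdist_lt => e e0; rewrite near_withinE.
have c0 : 0 < `|c| + 1 by rewrite ltr_wpDl.
apply/nbhs_normP; exists (e / (`|c| + 1)); first by rewrite /= divr_gt0.
move=> w /= wz Aw; apply: (le_lt_trans (H _ _ Az Aw)).
rewrite ltr_pdivlMr// in wz; apply: le_lt_trans wz.
rewrite mulrC ler_wpM2l// (le_trans (ler_norm _))// lerDl//.
Qed.

End Continuity.

(** * The inner product *)

Section EuclideanSpace.
Context {R : realType} {n : nat}.
Implicit Types (x y z v w zeta : 'rV[R]_n) (N : 'rV[R]_n -> R).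

Lemma dotDl x y z : dot (x + y) z = dot x z + dot y z.
Proof.
by rewrite /dot -big_split; apply: eq_bigr => i _; rewrite mxE mulrDl.
Qed.

Lemma dotC x y : dot x y = dot y x.
Proof. by apply: eq_bigr => i _; rewrite mulrC. Qed.

Lemma dotZl (a : R) x y : dot (a *: x) y = a * dot x y.
Proof. by rewrite /dot mulr_sumr; apply: eq_bigr => i _; rewrite mxE mulrA. Qed.

Lemma dotDr x y z : dot x (y + z) = dot x y + dot x z.
Proof. by rewrite dotC dotDl !(dotC x). Qed.

Lemma dotZr (a : R) x y : dot x (a *: y) = a * dot x y.
Proof. by rewrite dotC dotZl dotC. Qed.

Lemma dotNl x y : dot (- x) y = - dot x y.
Proof. by rewrite -scaleN1r dotZl mulN1r. Qed.

Lemma dotNr x y : dot x (- y) = - dot x y.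
Proof. by rewrite dotC dotNl dotC. Qed.

(** Rewriting with this rule and closing with [ring] or [lra] settles every
    bilinear identity. *)
Definition dot_linear := (dotDl, dotDr, dotNl, dotNr, dotZl, dotZr).

Lemma dot0l x : dot 0 x = 0.
Proof. by rewrite -(scale0r 0) dotZl mul0r. Qed.

Lemma coord_le_norm x i : `|x 0 i| <= `|x|.
Proof.
rewrite [leRHS]/Num.norm /= mx_normrE.
by apply/bigmax_geP; right; exists (0, i).
Qed.

Lemma dot_le_norm x y : `|dot x y| <= n%:R * `|x| * `|y|.
Proof.
rewrite /dot (le_trans (ler_norm_sum _ _ _))//.
rewrite (le_trans (y := \sum_(i < n) `|x| * `|y|))//.
  by apply: ler_sum => i _; rewrite normrM ler_pM// coord_le_norm.
by rewrite sumr_const card_ord -[leLHS]mulr_natl mulrA.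
Qed.

Lemma norm_sqr_le_dot x : `|x| ^+ 2 <= dot x x.
Proof.
have d0 : 0 <= dot x x by apply: sumr_ge0 => i _; rewrite -expr2 sqr_ge0.
rewrite -ler_sqrt// sqrtr_sqr normr_id [leLHS]/Num.norm /= mx_normrE.
apply/bigmax_leP; split; first exact: sqrtr_ge0.
move=> [i j] _ /=; rewrite -sqrtr_sqr ler_sqrt// /dot (bigD1 j)//= ord1 -expr2.
by rewrite lerDl; apply: sumr_ge0 => k _; rewrite -expr2 sqr_ge0.
Qed.

Lemma dot_continuous : continuous (fun x => dot x x).
Proof.
apply: continuous_big => [|i _ x]; first exact: add_continuous.
by apply: continuousM; exact: coord_continuous.
Qed.

End EuclideanSpace.
(** * Equivalence of norms and the dual norm *)

Section NormEquivalence.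
Context {R : realType} {n : nat}.
Implicit Types (v w zeta : 'rV[R]_n) (N : 'rV[R]_n -> R).

Lemma is_norm0 N : is_norm N -> N 0 = 0.
Proof. by move=> [_ NZ _]; rewrite -(scale0r 0) NZ normr0 mul0r. Qed.

Lemma is_normN N v : is_norm N -> N (- v) = N v.
Proof. by move=> [_ NZ _]; rewrite -scaleN1r NZ normrN1 mul1r. Qed.

Lemma is_norm_ge0 N v : is_norm N -> 0 <= N v.
Proof.
move=> Nn; have [ND _ _] := Nn.
have := ND v (- v); rewrite subrr is_norm0// is_normN//; lra.
Qed.

Lemma is_norm_bounded N : is_norm N ->
  exists2 c, 0 < c & forall v, N v <= c * `|v|.
Proof.
move=> Nn; have [ND NZ _] := Nn.
pose c := \sum_(i < n) N (delta_mx 0 i).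
have c0 : 0 <= c by apply: sumr_ge0 => i _; exact: is_norm_ge0.
exists (c + 1) => [|v]; first by rewrite ltr_wpDl.
apply: (le_trans (y := c * `|v|)); last by rewrite ler_wpM2r// lerDl.
rewrite [in leLHS](row_sum_delta v) /c mulr_suml.
apply: (big_ind2 (fun w b => N w <= b)) => [|w a w' b wa wb|i _].
- by rewrite is_norm0.
- by rewrite (le_trans (ND _ _))// lerD.
- by rewrite NZ mulrC ler_wpM2l ?is_norm_ge0// coord_le_norm.
Qed.

(** A norm is Lipschitz for the sup norm, so it attains on the compact unit sphere
    of the sup norm a minimum, which is positive. *)
Lemma norm_le_is_norm N : is_norm N ->
  exists2 c, 0 < c & forall v, `|v| <= c * N v.
Proof.
move=> Nn; have [ND NZ N0] := Nn.
have [C C0 NC] := is_norm_bounded Nn.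
pose S := [set v : 'rV[R]_n | `|v| = 1].
(* The sphere is empty exactly when n = 0. *)
have [S0|S0] := pselect (S !=set0); last first.
  exists 1 => // v; rewrite mul1r.
  have [->|v0] := eqVneq v 0; first by rewrite normr0 is_norm0.
  exfalso; apply: S0; exists (`|v|^-1 *: v).
  by rewrite /S /= normrZ normfV normr_id mulVf// normr_eq0.
have cS : compact S.
  apply: bounded_closed_compact.
    by exists 1; split => // M M1 v /= ->; exact: ltW.
  apply: (@closed_comp _ _ (fun v : 'rV[R]_n => `|v|) [set x | x = 1]).
    by move=> v _; exact: norm_continuous.
  exact: closed_eq.
have cN : {within S, continuous N}.
  apply: (@lipschitz_within_continuous _ _ R^o _ _ C) => v w _ _.
  have := ND (v - w) w; have := ND (w - v) v; rewrite !subrK.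
  have := NC (v - w); have := NC (w - v); rewrite (distrC w).
  rewrite -(opprB v w) is_normN// => *.
  by rewrite ler_norml; apply/andP; split; lra.
have [v0 /set_mem v0S v0min] := EVT_min_rV S0 cS cN.
have Nv0 : 0 < N v0.
  rewrite lt_neqAle is_norm_ge0// andbT eq_sym; apply/eqP => /N0 v00.
  by move: v0S; rewrite /S /= v00 normr0 => /esym/eqP; rewrite oner_eq0.
exists (N v0)^-1 => [|v]; first by rewrite invr_gt0.
have [->|vn0] := eqVneq v 0; first by rewrite normr0 is_norm0 ?mulr0.
have vp : 0 < `|v| by rewrite normr_gt0.
have : N v0 <= N (`|v|^-1 *: v).
  by apply/v0min/mem_set; rewrite /S /= normrZ normfV normr_id mulVf ?gt_eqF.
rewrite NZ normfV normr_id mulrC ler_pdivlMr// => h.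
by rewrite mulrC ler_pdivlMr// mulrC.
Qed.

(** The supremum defining [dual_norm] bounds the inner products only when it is
    taken over a bounded set; this is where equivalence of norms enters. *)
Lemma dot_le_dual_norm N zeta v : is_norm N ->
  dot zeta v <= dual_norm N zeta * N v.
Proof.
move=> Nn; have [ND NZ N0] := Nn.
have [c c0 cN] := norm_le_is_norm Nn.
have [v0|vN0] := eqVneq (N v) 0.
  by rewrite (N0 _ v0) dotC dot0l is_norm0// mulr0.
have vp : 0 < N v by rewrite lt_neqAle eq_sym vN0 is_norm_ge0.
rewrite -ler_pdivrMr// mulrC -dotZr.
apply: ub_le_sup; last first.
  by exists ((N v)^-1 *: v) => //=; rewrite NZ normfV gtr0_norm// mulVf.
exists (n%:R * `|zeta| * c) => _ [w /= Nw <-].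
rewrite (le_trans (ler_norm _))// (le_trans (dot_le_norm _ _))//.
rewrite ler_wpM2l ?mulr_ge0// (le_trans (cN w))//.
by rewrite -[leRHS]mulr1 ler_pM2l.
Qed.

End NormEquivalence.

(** * Subgradients near every point of a compact convex set *)

Section ConvexFunctions.
Context {R : realType} {n : nat}.
Implicit Types (X : set 'rV[R]_n) (h : 'rV[R]_n -> R).

Lemma convex_set_segment X y z (s : R) :
  convex_set X -> X y -> X z -> 0 <= s -> s <= 1 -> X (z + s *: (y - z)).
Proof.
move=> cX Xy Xz s0 s1.
have s01 : Itv.spec (@Itv.num_sem R) (Itv.Real `[0%Z, 1%Z]) s.
  by rewrite /= /Itv.num_sem/= num_real in_itv/= s0 s1.
have := cX y z (Itv.mk s01) (mem_set Xy) (mem_set Xz).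
rewrite inE; congr (X _).
by rewrite /conv/= /unstable.onem scalerBr scalerBl scale1r addrCA.
Qed.

Lemma convex_function_segment X h y z (s : R) :
  convex_function X h -> X y -> X z -> 0 <= s -> s <= 1 ->
  h (z + s *: (y - z)) <= h z + s * (h y - h z).
Proof.
move=> ch Xy Xz s0 s1.
have s01 : Itv.spec (@Itv.num_sem R) (Itv.Real `[0%Z, 1%Z]) s.
  by rewrite /= /Itv.num_sem/= num_real in_itv/= s0 s1.
have := ch (Itv.mk s01) y z (mem_set Xy) (mem_set Xz).
rewrite convRE /unstable.onem /=.
have -> : z + s *: (y - z) = s *: y + (1 - s) *: z.
  by rewrite scalerBr scalerBl scale1r addrCA.
move/le_trans; apply; rewrite le_eqVlt; apply/orP; left; apply/eqP; ring.
Qed.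

(** Minimise [h + M |. - p|^2] over [X].  At a minimiser [w], convexity turns the
    first-order condition into [2 M (p - w)] being a subgradient of [h], and
    comparison with the value at [p] gives [M |w - p|^2 <= h p - min h], so a
    large [M] brings [w] close to [p]. *)
Lemma near_subgradient X h p (d : R) :
  compact X -> convex_set X -> convex_function X h ->
  {within X, continuous h} -> X p -> 0 < d ->
  exists w zeta, [/\ X w, `|w - p| < d, subdifferential X h w zeta
                   & 0 <= dot zeta (p - w)].
Proof.
move=> kX cX ch hX Xp d0.
have X0 : X !=set0 by exists p.
have [a /set_mem Xa amin] := EVT_min_rV X0 kX hX.
have pa : h a <= h p by apply/amin/mem_set.
pose M := (h p - h a + 1) / d ^+ 2.
have M0 : 0 < M by rewrite divr_gt0 ?exprn_gt0// ltr_wpDl// subr_ge0.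
have cq : continuous (fun y : 'rV[R]_n => M * dot (y - p) (y - p) : R^o).
  move=> y.
  have cB : {for y, continuous (fun y : 'rV[R]_n => y - p)}.
    exact: (cvgB cvg_id (cvg_cst p)).
  have cD : {for y, continuous (fun y : 'rV[R]_n => dot (y - p) (y - p))}.
    refine (@continuous_comp _ _ _ _ (fun y => dot y y) y cB
      (@dot_continuous R n (y - p))).
  exact: (cvgM (cvg_cst M) cD).
have cQ : {within X, continuous (fun y => h y + M * dot (y - p) (y - p))}.
  exact: (@within_continuousD _ R R^o X h _ hX (continuous_subspaceT cq)).
have [w /set_mem Xw wmin] := EVT_min_rV X0 kX cQ.
exists w, ((2 * M) *: (p - w)); split => //.
- have := wmin _ (mem_set Xp); rewrite subrr dot0l mulr0 addr0 => wp.
  have aw := amin _ (mem_set Xw).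
  have Q : `|w - p| ^+ 2 < d ^+ 2.
    apply: le_lt_trans (norm_sqr_le_dot _) _.
    rewrite -(ltr_pM2l M0) {2}/M divfK ?gt_eqF ?exprn_gt0//; lra.
  by rewrite -(@ltr_pXn2r _ 2)// nnegrE// ltW.
- move=> y Xy; rewrite -subr_ge0.
  (* Compare w with w + s (y - w) and divide by s: the quadratic remainder is
     s M |y - w|^2. *)
  apply: (@ge0_perturb _ _ (M * dot (y - w) (y - w))) => s s0 s1.
  have Xs := convex_set_segment cX Xy Xw (ltW s0) s1.
  have := convex_function_segment ch Xy Xw (ltW s0) s1.
  have := wmin _ (mem_set Xs).
  have -> : w + s *: (y - w) - p = (w - p) + s *: (y - w) by rewrite addrAC.
  have -> : p - w = - (w - p) by rewrite opprB.
  set r := w - p; set q := y - w; set hs := h (w + _).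
  move: r q hs => r q hs; rewrite !dot_linear (dotC q r) => h1 h2.
  rewrite -(pmulr_rge0 _ s0); lra.
- rewrite dotZl mulr_ge0//; first by rewrite mulr_ge0// ltW.
  exact: le_trans (sqr_ge0 _) (norm_sqr_le_dot _).
Qed.

End ConvexFunctions.
(** * Consequences of the proximal setup *)

Section Proximal.
Context {R : realType} {n : nat} (X : set 'rV[R]_n) (N : 'rV[R]_n -> R)
  (omega : 'rV[R]_n -> R) (domega : 'rV[R]_n -> 'rV[R]_n) (Omega : R)
  (X_compact : compact X) (X_convex : convex_set X)
  (setup : proximal_setup X N omega domega Omega).
Implicit Types w x y z zeta xi : 'rV[R]_n.

Local Notation V := (bregman omega domega).
Local Notation X0 := (dom_subdiff X omega).

(** The point [p := z + s (y - z)] may have no subgradient, so the subgradient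
    inequality is used at a nearby [w] in Z°:
    [omega w - omega z <= <domega w, w - z>].  As [w] tends to [z], continuity of
    [domega] replaces [domega w] by [domega z].  The distance from [w] to [p] is
    chosen after [s], small enough for the error to be a fraction of [s * eta].
    By convexity one [s] suffices in the applications. *)
Lemma directional_derivative_le z y (eta : R) : X0 z -> X y -> 0 < eta ->
  exists s : R, [/\ 0 < s, s <= 1 &
    omega (z + s *: (y - z)) - omega z <= s * (dot (domega z) (y - z) + eta)].
Proof.
move=> z0 Xy eta0; have Xz := z0.1.
pose K := n%:R + 1 : R; pose L := `|y - z| + 1; pose D := `|domega z| + 1.
have K0 : 0 < K by rewrite ltr_wpDl.
have L0 : 0 < L by rewrite ltr_wpDl.
have D0 : 0 < D by rewrite ltr_wpDl.
pose kappa := eta / (4 * K * L).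
have kappa0 : 0 < kappa by rewrite divr_gt0// !mulr_gt0.
have [delta delta0 dcont] := within_continuous_dist
  (ps_grad_continuous setup) z0 kappa0.
have [s [s0 s1 sL]] : exists s : R, [/\ 0 < s, s <= 1 & s * L <= delta / 2].
  exists (Num.min 1 (delta / (2 * L))); split.
  - by rewrite lt_min ltr01 divr_gt0// mulr_gt0.
  - by rewrite ge_min lexx.
  - by rewrite -ler_pdivlMr// ge_min invfM mulrA lexx orbT.
pose p := z + s *: (y - z).
have Xp : X p by apply: convex_set_segment => //; exact: ltW.
have se0 : 0 < s * eta / 4 by rewrite divr_gt0// mulr_gt0.
have [d1 d10 ocont] := within_continuous_dist (ps_continuous setup) Xp se0.
pose d := Num.min (Num.min (delta / 2) d1) (Num.min s (s * eta / (4 * K * D))).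
have d0 : 0 < d.
  by rewrite !lt_min d10 s0 !divr_gt0 ?mulr_gt0.
have [w [zeta [Xw wp sw _]]] := near_subgradient X_compact X_convex
  (ps_convex setup) (ps_continuous setup) Xp d0.
have w0 : X0 w by split => //; exists zeta.
move: wp; rewrite !lt_min => /andP[/andP[wp1 wp2] /andP[wp3 wp4]].
exists s; split => //; rewrite -/p.
have wz : `|w - z| <= s * L.
  have -> : w - z = (w - p) + s *: (y - z) by rewrite /p opprD addrA subrK.
  rewrite (le_trans (ler_normD _ _))// normrZ gtr0_norm// /L; lra.
have wz' : `|w - z| < delta by rewrite (le_lt_trans wz)//; lra.
have dd := dcont _ w0 wz'.
have od := ocont _ Xw wp2.
have ow := ps_subgradient setup w0 Xz.
have E1 : dot (domega w - domega z) (w - z) <= s * eta / 4.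
  rewrite (le_trans (ler_norm _))// (le_trans (dot_le_norm _ _))//.
  rewrite (le_trans (y := K * kappa * (s * L)))//.
    by rewrite ler_pM// ?ler_pM// ?mulr_ge0// ?lerDl// ltW.
  rewrite le_eqVlt; apply/orP; left; apply/eqP; rewrite /kappa; field.
  by rewrite !gt_eqF.
have E2 : dot (domega z) (w - p) <= s * eta / 4.
  rewrite (le_trans (ler_norm _))// (le_trans (dot_le_norm _ _))//.
  rewrite (le_trans (y := K * D * (s * eta / (4 * K * D))))//.
    by rewrite ler_pM// ?ler_pM// ?mulr_ge0// ?lerDl// ltW.
  rewrite le_eqVlt; apply/orP; left; apply/eqP; field.
  by rewrite !gt_eqF.
have E3 : dot (domega w) (w - z) = dot (domega w - domega z) (w - z)
    + dot (domega z) (w - p) + s * dot (domega z) (y - z).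
  by rewrite /p !dot_linear; ring.
have E4 : dot (domega w) (z - w) = - dot (domega w) (w - z).
  by rewrite -dotNr opprB.
have := ler_norm (omega p - omega w); rewrite distrC => E5; lra.
Qed.

(** The selected subgradient realises the directional derivatives of [omega] into
    [X], and these dominate all subgradients. *)
Lemma domega_maximal z y zeta : X0 z -> X y -> subdifferential X omega z zeta ->
  dot zeta (y - z) <= dot (domega z) (y - z).
Proof.
move=> z0 Xy sz; rewrite -subr_ge0; apply: (@ge0_perturb _ _ 1) => eta eta0 _.
have [s [s0 s1 h]] := directional_derivative_le z0 Xy eta0.
have := sz _ (convex_set_segment X_convex Xy z0.1 (ltW s0) s1).
rewrite addrAC subrr add0r dotZr mul1r => h'.
have : 0 <= s * (dot (domega z) (y - z) - dot zeta (y - z) + eta) by lra.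
by rewrite pmulr_rge0.
Qed.

(** The sign of [dot (domega w) (p - w)] makes up for the lack of a bound on
    [domega w], which may be large when [w] is near the edge of Z°. *)
Lemma near_dom_subdiff p (d : R) : X p -> 0 < d ->
  exists w, [/\ X0 w, `|w - p| < d & 0 <= dot (domega w) (p - w)].
Proof.
move=> Xp d0; have [w [zeta [Xw wp sw pw]]] := near_subgradient X_compact
  X_convex (ps_convex setup) (ps_continuous setup) Xp d0.
have w0 : X0 w by split => //; exists zeta.
by exists w; split => //; apply: (le_trans pw); exact: domega_maximal.
Qed.

Lemma bregman_ge0 z y : X0 z -> X y -> 0 <= V z y.
Proof.
by move=> z0 Xy; have := ps_subgradient setup z0 Xy; rewrite /bregman; lra.
Qed.

(** If [V] dominates [sigma N^2], apply this on both halves of the segment from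
    [z] to [y]: with [w] the midpoint,
    [V z y = V w y + V z w + <domega w - domega z, y - w>], and the last term is
    at least [N (w - z) ^+ 2] because [y - w = w - z].  All three squares are
    [N (y - z) ^+ 2 / 4], whence the modulus [1/4 + sigma/2].  The midpoint [p]
    need not lie in Z°, so [w] is only near [p], and
    [y - w = (w - z) + 2 (p - w)]. *)
Lemma bregman_modulus_improve (sigma : R) : 0 <= sigma ->
  (forall z y, X0 z -> X y -> sigma * N (y - z) ^+ 2 <= V z y) ->
  forall z y, X0 z -> X y -> (1 / 4 + sigma / 2) * N (y - z) ^+ 2 <= V z y.
Proof.
move=> sigma0 H z y z0 Xy.
have Nn := ps_norm setup; have [ND NZ _] := Nn.
have [C C0 NC] := is_norm_bounded Nn.
pose a := N (y - z) / 2.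
have a0 : 0 <= a by rewrite divr_ge0// is_norm_ge0.
pose p := z + 2^-1 *: (y - z).
have Xp : X p.
  by apply: convex_set_segment => //; [exact: z0.1|rewrite invf_le1//; lra].
have pz : p - z = 2^-1 *: (y - z) by rewrite /p addrAC subrr add0r.
have yp : y - p = 2^-1 *: (y - z).
  by apply/rowP => i; rewrite /p !mxE; lra.
have Npz : N (p - z) = a.
  by rewrite pz NZ gtr0_norm ?invr_gt0// /a mulrC.
have Nyp : N (y - p) = a.
  by rewrite yp NZ gtr0_norm ?invr_gt0// /a mulrC.
pose B := 2 * (n%:R * `|domega z|) + (1 + 2 * sigma) * (2 * a * C).
rewrite -subr_ge0; apply: (@ge0_perturb _ _ B) => d d0 _.
have [w [w0 wp dwp]] := near_dom_subdiff Xp d0.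
have Nwp : N (w - p) <= C * d.
  by rewrite (le_trans (NC _))// ler_pM2l// ltW.
have h1 := H _ _ w0 Xy; have h2 := H _ _ z0 w0.1.
have h3 := ps_strongly_convex setup w0 z0.
have sq u : a - C * d <= u -> a ^+ 2 - 2 * a * C * d <= u ^+ 2.
  by move=> ua; have := sqr_ge0 (u - a); nra.
have wz : a ^+ 2 - 2 * a * C * d <= N (w - z) ^+ 2.
  apply: sq; have := ND (p - w) (w - z).
  by rewrite addrA subrK Npz -(opprB w p) is_normN//; lra.
have yw : a ^+ 2 - 2 * a * C * d <= N (y - w) ^+ 2.
  apply: sq; have := ND (y - w) (w - p).
  by rewrite addrA subrK Nyp; lra.
have E : - (n%:R * `|domega z| * d) <= dot (domega z) (w - p).
  have := ler_norm (- dot (domega z) (w - p)); rewrite normrN => h.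
  have := dot_le_norm (domega z) (w - p) => h'.
  have : n%:R * `|domega z| * `|w - p| <= n%:R * `|domega z| * d.
    by rewrite ler_wpM2l ?mulr_ge0// ltW.
  by move=> h''; lra.
have yE : y - w = (w - z) + 2 *: (p - w).
  by apply/rowP => i; rewrite /p !mxE; lra.
have Vz : V z y = V w y + V z w + dot (domega w - domega z) (y - w).
  by rewrite /bregman !dot_linear; ring.
have h4 : dot (domega w - domega z) (y - w) =
    dot (domega w - domega z) (w - z) + 2 * dot (domega w) (p - w)
    + 2 * dot (domega z) (w - p).
  by rewrite [in LHS]yE !dot_linear; ring.
have Na : N (y - z) = 2 * a by rewrite /a; field.
rewrite Na /B; nra.
Qed.

(** Monotonicity of [domega] with modulus 1 only bounds [V z y + V y z].  The
    modulus 1/2 for [V] alone is the fixed point of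
    [sigma |-> 1/4 + sigma/2], approached by iterating
    [bregman_modulus_improve] from the modulus 0. *)
Lemma bregman_ge_sqr z y : X0 z -> X y -> N (y - z) ^+ 2 / 2 <= V z y.
Proof.
move=> z0 Xy.
have H (k : nat) : forall z y, X0 z -> X y ->
    (1 / 2 - 1 / 2 / k.+1%:R) * N (y - z) ^+ 2 <= V z y.
  elim: k => [|k IH] {z0 Xy}{}z {}y z0 Xy.
    by rewrite divr1 subrr mul0r bregman_ge0.
  have k0 : 0 < k.+1%:R :> R by [].
  have k1 : 1 <= k.+1%:R :> R by rewrite ler1n.
  have s0 : 0 <= 1 / 2 - 1 / 2 / k.+1%:R :> R.
    by rewrite subr_ge0 ler_pdivrMr//; lra.
  (* The iterates converge geometrically; 1 / k.+1 is a convenient upper bound on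
     twice the gap. *)
  apply: le_trans (bregman_modulus_improve s0 IH z0 Xy).
  apply: ler_wpM2r; first exact: sqr_ge0.
  rewrite -[k.+2%:R]natr1; set c := k.+1%:R.
  rewrite -subr_ge0.
  have -> : 1 / 4 + (1 / 2 - 1 / 2 / c) / 2 - (1 / 2 - 1 / 2 / (c + 1))
      = (c - 1) / (4 * c * (c + 1)).
    by field; rewrite !gt_eqF// ltr_wpDr// ltW.
  by rewrite divr_ge0// ?subr_ge0// !mulr_ge0// ?addr_ge0// ltW.
rewrite -subr_ge0.
apply: (@ge0_perturb_harmonic _ _ (N (y - z) ^+ 2 / 2)) => k.
have := H k z y z0 Xy; set r := (k.+1%:R)^-1; lra.
Qed.

Lemma omega_centerP : X0 (omega_center X omega).
Proof.
have [Xc cmin] : minimizers X omega (omega_center X omega).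
  exact: getPex (ps_center_ex setup).
by split => //; exists 0 => y Xy; rewrite dot0l addr0 cmin.
Qed.

(** Minimality of the prox point [w] says that [domega z - xi] is some
    subgradient of [omega] at [w]; [domega_maximal] compares it with the selected
    one. *)
Lemma proxP z xi : X0 z -> X0 (prox X omega domega z xi) /\
  forall y, X y -> dot (domega z - xi - domega (prox X omega domega z xi))
                       (y - prox X omega domega z xi) <= 0.
Proof.
move=> z0; set w := prox X omega domega z xi.
have [Xw wmin] : minimizers X (fun y => dot xi y + V z y) w.
  exact: getPex (ps_prox_ex setup xi z0).
have sw : subdifferential X omega w (domega z - xi).
  by move=> y Xy; have := wmin _ Xy; rewrite /bregman !dot_linear; lra.
have w0 : X0 w by split => //; exists (domega z - xi).
split=> // y Xy; have := domega_maximal w0 Xy sw.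
by rewrite [X in _ -> X <= _]dotDl dotNl; lra.
Qed.

(** [V z y - V w y = V z w + <domega w - domega z, y - w>], where [w] is the prox
    point.  [proxP] bounds the inner product below by [- dot xi (y - w)], and
    [dot xi (z - w) - V z w <= c N - N^2/2 <= c^2/2] with [N := N (w - z)]. *)
Lemma prox_descent z y xi (c : R) : X0 z -> X y ->
  (forall v, dot xi v <= c * N v) ->
  dot xi (z - y) <= V z y - V (prox X omega domega z xi) y + c ^+ 2 / 2.
Proof.
move=> z0 Xy xic; have [] := proxP xi z0.
set w := prox X omega domega z xi => w0 /(_ _ Xy) opt.
have := bregman_ge_sqr z0 w0.1.
have := xic (z - w); rewrite -(opprB w z) (is_normN _ (ps_norm setup)).
have := sqr_ge0 (c - N (w - z)).
move: opt; rewrite /bregman !dot_linear; lra.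
Qed.

(** [h - alpha omega] is convex, so its increment from [z] to [y] is at least its
    slope over a short step.  There [h] grows at least like [zeta], and [omega]
    at most like [domega z] by [directional_derivative_le]. *)
Lemma relative_strong_convexity (h : 'rV[R]_n -> R) (alpha : R) z y zeta :
  0 < alpha -> convex_function X (fun v => h v - alpha * omega v) ->
  X0 z -> X y -> subdifferential X h z zeta ->
  h z + dot zeta (y - z) + alpha * V z y <= h y.
Proof.
move=> alpha0 ch z0 Xy sz; rewrite -subr_ge0.
apply: (@ge0_perturb _ _ alpha) => eta eta0 _.
have [s [s0 s1 hs]] := directional_derivative_le z0 Xy eta0.
have := sz _ (convex_set_segment X_convex Xy z0.1 (ltW s0) s1).
rewrite addrAC subrr add0r dotZr.
have /= := convex_function_segment ch Xy z0.1 (ltW s0) s1.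
move: hs; set p := z + _; rewrite -(ler_pM2l alpha0) => h1 h2 h3.
rewrite -(pmulr_rge0 _ s0) /bregman; lra.
Qed.

End Proximal.
(** * Averages with the weights theta *)

Section ThetaWeights.
Context {R : realType}.
Implicit Types (T t : nat).

Lemma theta_ge0 T t : 0 <= theta T t :> R.
Proof. by rewrite /theta divr_ge0// mulr_ge0. Qed.

(** The theta-means obey the recursion of a running average with step
    [2 / (T + 2)]; normalisation of the weights and Jensen's inequality follow by
    induction on [T]. *)
Lemma theta_mean_step (V : lmodType R) (x : nat -> V) T : (1 <= T)%N ->
  \sum_(1 <= t < T.+2) theta T.+1 t *: x t =
  let m := \sum_(1 <= t < T.+1) theta T t *: x t in
  m + (2 / T.+2%:R) *: (x T.+1 - m).
Proof.
move=> T1 /=; set m := \sum_(1 <= t < T.+1) _.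
have T0 : T%:R != 0 :> R by rewrite pnatr_eq0 -lt0n.
rewrite big_nat_recr//=.
have -> : theta T.+1 T.+1 = 2 / T.+2%:R :> R.
  by rewrite /theta -!natr1; field; rewrite !natr1 !pnatr_eq0.
have -> : \sum_(1 <= t < T.+1) theta T.+1 t *: x t = (1 - 2 / T.+2%:R) *: m.
  rewrite /m scaler_sumr; apply: eq_bigr => t _; rewrite scalerA.
  congr (_ *: _); rewrite /theta -!natr1; field.
  by rewrite !natr1 T0 !pnatr_eq0.
by rewrite scalerBr scalerBl scale1r addrA addrAC.
Qed.

Lemma theta_mean1 (V : lmodType R) (x : nat -> V) :
  \sum_(1 <= t < 2) theta 1 t *: x t = x 1%N.
Proof.
by rewrite big_nat1 /theta mulr1 mul1r divff ?scale1r// pnatr_eq0.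
Qed.

Lemma sum_theta T : (1 <= T)%N -> \sum_(1 <= t < T.+1) theta T t = 1 :> R.
Proof.
elim: T => // -[_ _|T IH _].
  by rewrite big_nat1 /theta mulr1 mul1r divff// pnatr_eq0.
have /= := @theta_mean_step R^o (fun=> 1) T.+1 isT.
have E S : \sum_(1 <= t < S.+1) theta S t *: (1 : R^o)
    = \sum_(1 <= t < S.+1) theta S t.
  by apply: eq_bigr => t _; rewrite -[LHS]/(theta S t * 1) mulr1.
by rewrite !E IH// subrr scaler0 addr0.
Qed.

Lemma theta_jensen n (X : set 'rV[R]_n) (h : 'rV[R]_n -> R)
    (x : nat -> 'rV[R]_n) T :
  convex_set X -> convex_function X h -> (forall t, (1 <= t)%N -> X (x t)) ->
  (1 <= T)%N ->
  let m := \sum_(1 <= t < T.+1) theta T t *: x t in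
  X m /\ h m <= \sum_(1 <= t < T.+1) theta T t * h (x t).
Proof.
move=> cX ch Xx; elim: T => // -[_ _|T IH _] /=.
  rewrite theta_mean1; split; first exact: Xx.
  by rewrite (theta_mean1 (fun t => h (x t) : R^o)).
have [Xm hm] := IH isT.
rewrite theta_mean_step//= (@theta_mean_step R^o (fun t => h (x t)))//=.
set m := \sum_(1 <= t < T.+2) theta T.+1 t *: x t in Xm hm *.
set s := 2 / T.+3%:R.
have s0 : 0 <= s by rewrite divr_ge0.
have s1 : s <= 1 by rewrite ler_pdivrMr// mul1r ler_nat.
have XT := Xx T.+2 isT.
split; first exact: convex_set_segment.
apply: (le_trans (convex_function_segment ch XT Xm s0 s1)).
move: hm; rewrite -[s *: _]/(s * _) => hm.
have : 0 <= (1 - s) * (\sum_(1 <= t < T.+2) theta T.+1 t * h (x t) - h m).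
  by rewrite mulr_ge0// subr_ge0.
rewrite -[\sum_(1 <= t < T.+2) _ *: _]/(
  \sum_(1 <= t < T.+2) theta T.+1 t * h (x t)).
lra.
Qed.

(** Since [theta T t] is [t] up to a factor depending on [T] only, it is enough
    to sum [t * a t].  There the coefficients of [v t] combine to
    [alpha / 2 * ((t - 1) t v_t - t (t + 1) v_{t+1})], which telescopes to a
    nonpositive quantity. *)
Lemma theta_telescope (a v : nat -> R) (alpha G : R) T :
  0 < alpha -> (forall t, (1 <= t)%N -> 0 <= v t) ->
  (forall t, (1 <= t)%N -> a t <=
     alpha * t.+1%:R / 2 * (v t - v t.+1) + G ^+ 2 / (alpha * t.+1%:R)
     - alpha * v t) ->
  (1 <= T)%N ->
  \sum_(1 <= t < T.+1) theta T t * a t <= 2 * G ^+ 2 / (alpha * T.+1%:R).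
Proof.
move=> alpha0 v0 ha T1.
have H S : \sum_(1 <= t < S.+1) t%:R * a t <=
    S%:R * G ^+ 2 / alpha - alpha / 2 * (S%:R * S.+1%:R) * v S.+1.
  elim: S => [|S IH]; first by rewrite big_geq// !mul0r mulr0 mul0r subr0.
  rewrite big_nat_recr//=.
  have := ha S.+1 isT; rewrite -(ler_pM2l (ltr0Sn R S)) => h.
  have g : S.+1%:R * (G ^+ 2 / (alpha * S.+2%:R)) <= G ^+ 2 / alpha.
    have -> : S.+1%:R * (G ^+ 2 / (alpha * S.+2%:R))
        = G ^+ 2 / alpha * (S.+1%:R / S.+2%:R).
      by rewrite -!natr1; field; rewrite (gt_eqF alpha0) !natr1 pnatr_eq0.
    rewrite ler_piMr ?divr_ge0 ?sqr_ge0 ?(ltW alpha0)//.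
    by rewrite ler_pdivrMr// mul1r ler_nat.
  move: h g IH; set gg := G ^+ 2 / (alpha * _); move: gg => gg.
  by rewrite -[S.+2%:R]natr1 -[S.+1%:R]natr1; lra.
have T0 : 0 < T%:R :> R by rewrite ltr0n.
have := H T; rewrite -(ler_pM2l (_ : 0 < 2 / (T%:R * T.+1%:R))); last first.
  by rewrite divr_gt0// mulr_gt0.
rewrite mulr_sumr.
rewrite (eq_bigr (fun t => theta T t * a t)); last first.
  by move=> t _; rewrite /theta mulrA; congr (_ * _); rewrite mulrAC.
move/le_trans; apply; rewrite mulrBr.
have -> : 2 / (T%:R * T.+1%:R) * (T%:R * G ^+ 2 / alpha)
    = 2 * G ^+ 2 / (alpha * T.+1%:R).
  by field; rewrite !gt_eqF.
by rewrite lerBlDr lerDl !mulr_ge0// ?invr_ge0 ?mulr_ge0// ?(ltW alpha0)// v0.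
Qed.

Lemma sum_expr_le (beta : R) T : 0 < beta -> beta < 1 ->
  \sum_(1 <= t < T.+1) beta ^+ t <= (1 - beta)^-1.
Proof.
move=> b0 b1; rewrite -[leRHS]mul1r ler_pdivlMr ?subr_gt0//.
suff : (\sum_(1 <= t < T.+1) beta ^+ t) * (1 - beta) <= 1 - beta ^+ T.
  by move/le_trans; apply; rewrite gerBl exprn_ge0// ltW.
elim: T => [|T IH]; first by rewrite big_geq// mul0r subrr.
rewrite big_nat_recr//= mulrDl !exprS.
have := exprn_ge0 T (ltW b0); have := sqr_ge0 (1 - beta); nra.
Qed.

(** The weights are at most [2 / T], and the geometric series converges. *)
Lemma theta_mean_geometric (e : nat -> R) (C beta : R) T :
  0 < beta -> beta < 1 -> 0 <= C ->
  (forall t, (1 <= t)%N -> e t <= C * beta ^+ t) ->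
  (1 <= T)%N ->
  \sum_(1 <= t < T.+1) theta T t * e t <= 2 * C / (1 - beta) / T%:R.
Proof.
move=> b0 b1 C0 he T1.
have T0 : 0 < T%:R :> R by rewrite ltr0n.
have -> : 2 * C / (1 - beta) / T%:R = (2 * C / T%:R) * (1 - beta)^-1.
  by rewrite mulrAC.
apply: le_trans (ler_wpM2l _ (sum_expr_le T b0 b1)); last first.
  by rewrite divr_ge0// mulr_ge0.
rewrite mulr_sumr; apply: ler_sum_nat => t /andP[t1 tT].
apply: (le_trans (ler_wpM2l (theta_ge0 T t) (he _ t1))).
have tT2 : theta T t <= 2 / T%:R :> R.
  have -> : theta T t = 2 / T%:R * (t%:R / T.+1%:R) :> R.
    by rewrite /theta -[T.+1%:R]natr1; field; rewrite natr1 (gt_eqF T0) pnatr_eq0.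
  rewrite ler_piMr ?divr_ge0//.
  by rewrite ler_pdivrMr// mul1r ler_nat ltnW.
have -> : 2 * C / T%:R * beta ^+ t = 2 / T%:R * (C * beta ^+ t) by ring.
by rewrite ler_wpM2r// mulr_ge0// exprn_ge0// ltW.
Qed.

(** [T * beta ^+ T] is at most the sum of [beta ^+ t] over [1 <= t <= T]. *)
Lemma expr_le_harmonic (beta : R) T : 0 < beta -> beta < 1 -> (1 <= T)%N ->
  beta ^+ T <= (1 - beta)^-1 / T%:R.
Proof.
move=> b0 b1 T1; rewrite ler_pdivlMr ?ltr0n//.
apply: le_trans (sum_expr_le T b0 b1).
have -> : beta ^+ T * T%:R = \sum_(1 <= t < T.+1) beta ^+ T.
  by rewrite sumr_const_nat subSS subn0 mulr_natr.
apply: ler_sum_nat => t /andP[_ tT].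
by rewrite ler_wiXn2l// ?ltW.
Qed.

End ThetaWeights.
(** * Landau bounds for sequences *)

Section Asymptotics.
Context {R : realType}.

Lemma eqO_harmonic (a : nat -> R) (K : R) :
  (forall T, (1 <= T)%N -> `|a T| <= K / T%:R) ->
  (a : nat -> R^o) =O_\oo (fun T : nat => T%:R^-1 : R^o).
Proof.
move=> aK; apply/eqO_exP; exists (`|K| + 1); first by rewrite ltr_wpDl.
near=> T.
have T1 : (1 <= T)%N by near: T; exists 1%N.
apply: (le_trans (aK T T1)).
rewrite [`|T%:R^-1|]ger0_norm ?invr_ge0// ler_wpM2r ?invr_ge0//.
by rewrite (le_trans (ler_norm _))// lerDl.
Unshelve. all: by end_near. Qed.

(** The finitely many terms not covered by the Landau bound are absorbed by adding
    their ratios to the constant. *)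
Lemma geometric_bound (e : nat -> R) (beta : R) : 0 < beta ->
  (e : nat -> R^o) =O_\oo (fun t : nat => beta ^+ t : R^o) ->
  exists2 C : R, 0 <= C & forall t, `|e t| <= C * beta ^+ t.
Proof.
move=> b0 /eqO_exP[k k0 [M _ eM]].
exists (k + \sum_(i < M) `|e i| / beta ^+ i) => [|t].
  rewrite addr_ge0 ?(ltW k0)// sumr_ge0// => i _.
  by rewrite divr_ge0// exprn_ge0// ltW.
have bt : 0 < beta ^+ t by rewrite exprn_gt0.
have S0 : 0 <= \sum_(i < M) `|e i| / beta ^+ i.
  by rewrite sumr_ge0// => i _; rewrite divr_ge0// exprn_ge0// ltW.
have [Mt|tM] := leqP M t.
  apply: (le_trans (eM t Mt)); rewrite [`|beta ^+ t|]gtr0_norm//.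
  by rewrite ler_wpM2r ?(ltW bt)// lerDl.
rewrite -ler_pdivrMr// (bigD1 (Ordinal tM))//= addrCA lerDl addr_ge0 ?(ltW k0)//.
by rewrite sumr_ge0// => i _; rewrite divr_ge0// exprn_ge0// ltW.
Qed.

End Asymptotics.

(** * Mirror descent *)

Section MirrorDescent.
Context {R : realType} {n : nat} (X : set 'rV[R]_n) (N : 'rV[R]_n -> R)
  (omega : 'rV[R]_n -> R) (domega : 'rV[R]_n -> 'rV[R]_n) (Omega : R)
  (X_compact : compact X) (X_convex : convex_set X)
  (setup : proximal_setup X N omega domega Omega)
  (alpha : R) (g x : nat -> 'rV[R]_n)
  (x_init : x 1%N = omega_center X omega)
  (x_step : forall t, (1 <= t)%N ->
     x t.+1 = prox X omega domega (x t) (step_size alpha t *: g t)).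

Lemma iterates_dom_subdiff t : (1 <= t)%N -> dom_subdiff X omega (x t).
Proof.
elim: t => // -[_ _|t IH _].
  by rewrite x_init; exact: omega_centerP setup.
rewrite x_step//.
by have [] := proxP X_compact X_convex setup (step_size alpha t.+1 *: g t.+1)
  (IH isT).
Qed.

(** [prox_descent] divided by the step size is the hypothesis of
    [theta_telescope], with [v t] the Bregman distance from [x t] to [y]. *)
Lemma mirror_descent_regret (G : R) y T : 0 < alpha ->
  (forall t v, (1 <= t)%N -> dot (g t) v <= G * N v) -> X y -> (1 <= T)%N ->
  \sum_(1 <= t < T.+1) theta T t *
     (dot (g t) (x t - y) - alpha * bregman omega domega (x t) y)
  <= 2 * G ^+ 2 / (alpha * T.+1%:R).
Proof.
move=> alpha0 gG Xy T1.
apply: (theta_telescope (v := fun t => bregman omega domega (x t) y)) => //.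
  by move=> t t1; apply: (bregman_ge0 setup) => //; exact: iterates_dom_subdiff.
move=> t t1; rewrite lerD2r.
have gamma0 : 0 < step_size alpha t by rewrite divr_gt0// mulr_gt0.
have xic v : dot (step_size alpha t *: g t) v <= step_size alpha t * G * N v.
  by rewrite dotZl -mulrA ler_pM2l// gG.
have := prox_descent X_compact X_convex setup (iterates_dom_subdiff t1) Xy xic.
rewrite -x_step// dotZl => h.
rewrite -(ler_pM2l gamma0) (le_trans h)// le_eqVlt; apply/orP; left; apply/eqP.
rewrite /step_size -[t.+1%:R]natr1; field.
by rewrite natr1 pnatr_eq0 (gt_eqF alpha0).
Qed.

End MirrorDescent.

(** * The convergence rates *)

Theorem theorem10 (R : realType) (n : nat) (W : normedModType R)
    (X : set 'rV[R]_n) (U : set W)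
    (N : 'rV[R]_n -> R) (omega : 'rV[R]_n -> R)
    (domega : 'rV[R]_n -> 'rV[R]_n) (Omega D : R)
    (f : 'rV[R]_n -> W -> R) (df : 'rV[R]_n -> W -> 'rV[R]_n)
    (G alpha : R) (u : nat -> W) (x : nat -> 'rV[R]_n)
    (X_compact : compact X) (X_convex : convex_set X)
    (setup : proximal_setup X N omega domega Omega)
    (X_diameter : forall y y', X y -> X y' -> N (y - y') <= D)
    (G_gt0 : 0 < G) (alpha_gt0 : 0 < alpha)
    (f_convex : forall v, U v -> convex_function X (f^~ v))
    (df_subgradient : forall y v, X y -> U v ->
       subdifferential X (f^~ v) y (df y v))
    (df_bound : forall y v, X y -> U v -> dual_norm N (df y v) <= G)
    (f_rel_strongly_convex : forall v, U v ->
       convex_function X (fun y => f y v - alpha * omega y))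
    (u_in_U : forall t, (1 <= t)%N -> U (u t))
    (x_init : x 1%N = omega_center X omega)
    (x_step : forall t, (1 <= t)%N ->
       x t.+1 = prox X omega domega (x t)
                  (step_size alpha t *: df (x t) (u t))) :
  let q t y := dot (df (x t) (u t)) y
               + alpha * bregman omega domega (x t) y in
  let xbar T := \sum_(1 <= t < T.+1) theta T t *: x t in
  ((forall T, (1 <= T)%N ->
      \sum_(1 <= t < T.+1) theta T t * q t (x t)
      - inf [set \sum_(1 <= t < T.+1) theta T t * q t y | y in X]
      <= 2 * G ^+ 2 / (alpha * T.+1%:R)) /\
   (fun T : nat => 2 * G ^+ 2 / (alpha * T.+1%:R) : R^o)
     =O_\oo (fun T : nat => T%:R^-1 : R^o)) /\
  (forall (g : W -> R) (ustar : W) (GU LU beta : R),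
     minimizers U g ustar ->
     (exists2 mu : R, 0 < mu & strongly_convex_on U g mu) ->
     (exists2 L : R, 0 < L & smooth_on U g L) ->
     0 < GU -> 0 < LU ->
     (forall v v' y, U v -> U v' -> X y ->
        `|f y v - f y v'| <= GU * `|v - v'|) ->
     (forall v v' y, U v -> U v' -> X y ->
        dual_norm N (df y v - df y v') <= LU * `|v - v'|) ->
     0 < beta -> beta < 1 ->
     (fun t : nat => `|u t - ustar| : R^o)
       =O_\oo (fun t : nat => beta ^+ t : R^o) ->
     exists2 m : R, is_minimum X (f^~ ustar) m &
     exists A B : nat -> R^o,
       [/\ A =O_\oo (fun T : nat => T%:R^-1 : R^o),
           B =o_\oo (fun T : nat => T%:R^-1 : R^o)
         & forall T, (1 <= T)%N ->
             `|f (xbar T) (u T) - m| = A T + B T]).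
Proof.
move=> q xbar.
have x0 := iterates_dom_subdiff X_compact X_convex setup x_init x_step.
have Xx t : (1 <= t)%N -> X (x t) by move=> /x0[].
have Nn := ps_norm setup.
have G0 := ltW G_gt0.
have dfG y w v : X y -> U v -> dot (df y v) w <= G * N w.
  move=> Xy Uv; apply: le_trans (dot_le_dual_norm _ w Nn) _.
  by rewrite ler_wpM2r ?is_norm_ge0// df_bound.
have qE t y : q t (x t) - q t y =
    dot (df (x t) (u t)) (x t - y) - alpha * bregman omega domega (x t) y.
  by rewrite /q /bregman !dot_linear; ring.
have regret y T : X y -> (1 <= T)%N ->
    \sum_(1 <= t < T.+1) theta T t * (q t (x t) - q t y)
    <= 2 * G ^+ 2 / (alpha * T.+1%:R).
  move=> Xy T1; under eq_bigr do rewrite qE.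
  apply: (mirror_descent_regret X_compact X_convex setup x_init x_step) => //.
  by move=> t v t1; apply: dfG; [exact: Xx|exact: u_in_U].
have rate T : (1 <= T)%N ->
    2 * G ^+ 2 / (alpha * T.+1%:R) <= 2 * G ^+ 2 / alpha / T%:R.
  move=> T1; rewrite invfM mulrA ler_wpM2l ?divr_ge0 ?mulr_ge0 ?(ltW alpha_gt0)//.
  by rewrite lef_pV2 ?posrE ?ltr0n// ler_nat.
split; first split.
- move=> T T1; rewrite lerBlDr -lerBlDl.
  apply: lb_le_inf.
    exists (\sum_(1 <= t < T.+1) theta T t * q t (x 1%N)), (x 1%N) => //.
    exact: Xx.
  move=> _ [y Xy <-]; rewrite lerBlDr -lerBlDl -sumrB.
  by under eq_bigr do rewrite -mulrBr; exact: regret.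
- apply: (@eqO_harmonic _ _ (2 * G ^+ 2 / alpha)) => T T1.
  by rewrite ger0_norm ?rate// divr_ge0 ?mulr_ge0// ltW.
move=> g ustar GU LU beta [Uustar _] _ _ GU0 _ fU _ beta0 beta1 u_rate.
pose e t := `|u t - ustar|.
have [C C0 eC] := geometric_bound beta0 u_rate.
have {}eC t : e t <= C * beta ^+ t by rewrite -[e t]normr_id eC.
have [c c0 cN] := is_norm_bounded Nn.
have f_lip y z : X y -> X z -> f y ustar - f z ustar <= G * c * `|y - z|.
  move=> Xy Xz; have := df_subgradient _ _ Xy Uustar _ Xz.
  have := dfG y (y - z) ustar Xy Uustar; rewrite -(opprB y z) dotNr.
  have : G * N (y - z) <= G * c * `|y - z| by rewrite -mulrA ler_wpM2l.
  by lra.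
have fc : {within X, continuous (f^~ ustar)}.
  apply: (@lipschitz_within_continuous _ _ R^o _ _ (G * c)) => y z Xy Xz.
  have := f_lip y z Xy Xz; have := f_lip z y Xz Xy; rewrite (distrC z y).
  by rewrite ler_norml => *; apply/andP; split; lra.
have Xne : X !=set0 by exists (x 1%N); exact: Xx.
have [xs /set_mem Xxs xs_min] := EVT_min_rV Xne X_compact fc.
exists (f xs ustar).
  split; first by exists xs.
  by move=> _ [y Xy <-]; apply/xs_min/mem_set.
(* The regret bounds the optimality gap of the mean for u_t; moving from u_t to
   ustar costs GU * e t at x t and once more at xs. *)
have near_opt T : (1 <= T)%N -> 0 <= f (xbar T) ustar - f xs ustar <=
    2 * G ^+ 2 / (alpha * T.+1%:R)
    + 2 * GU * \sum_(1 <= t < T.+1) theta T t * e t.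
  move=> T1.
  have [Xm jensen] := theta_jensen X_convex (f_convex _ Uustar) Xx T1.
  rewrite subr_ge0 (xs_min _ (mem_set Xm))/=.
  apply: (@le_trans _ _ (\sum_(1 <= t < T.+1)
      theta T t * (f (x t) ustar - f xs ustar))).
    rewrite (eq_bigr (fun t => theta T t * f (x t) ustar
                               - theta T t * f xs ustar)); last first.
      by move=> t _; rewrite mulrBr.
    by rewrite sumrB -mulr_suml sum_theta// mul1r lerD2r.
  apply: le_trans (lerD (regret xs T Xxs T1) (lexx _)).
  rewrite mulr_sumr -big_split /=.
  apply: ler_sum_nat => t /andP[t1 tT].
  rewrite [2 * GU * _]mulrCA -mulrDr ler_wpM2l ?theta_ge0// qE.
  have Ut := u_in_U t t1; have Xt := Xx t t1.
  have := relative_strong_convexity X_compact X_convex setup alpha_gt0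
    (f_rel_strongly_convex _ Ut) (x0 t t1) Xxs (df_subgradient _ _ Xt Ut).
  have := fU _ _ _ Uustar Ut Xt; have := fU _ _ _ Ut Uustar Xxs.
  rewrite !ler_norml (distrC ustar) -/(e t) => /andP[_ h1] /andP[_ h2].
  have -> : x t - xs = - (xs - x t) by rewrite opprB.
  by rewrite dotNr; lra.
(* All error terms are O(1/T), so the o(1/T) summand may be taken to vanish. *)
exists (fun T => `|f (xbar T) (u T) - f xs ustar| : R^o), (fun=> 0 : R^o).
split; last by move=> T _; rewrite addr0.
  pose K := 2 * G ^+ 2 / alpha + 2 * GU * (2 * C / (1 - beta))
            + GU * (C * (1 - beta)^-1).
  apply: (@eqO_harmonic _ _ K) => T T1; rewrite normr_id.
  have /andP[opt0 opt1] := near_opt T T1.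
  have [Xm _] := theta_jensen X_convex (f_convex _ Uustar) Xx T1.
  have h1 := fU _ _ _ (u_in_U T T1) Uustar Xm.
  have h2 : GU * e T <= GU * (C * (1 - beta)^-1) / T%:R.
    rewrite -mulrA ler_pM2l// (le_trans (eC T))// -mulrA ler_wpM2l//.
    exact: expr_le_harmonic.
  have h3 : 2 * GU * (\sum_(1 <= t < T.+1) theta T t * e t)
      <= 2 * GU * (2 * C / (1 - beta)) / T%:R.
    rewrite -[leRHS]mulrA ler_wpM2l ?mulr_ge0 ?(ltW GU0)//.
    exact: theta_mean_geometric.
  have h4 := rate T T1.
  have -> : f (xbar T) (u T) - f xs ustar =
      (f (xbar T) (u T) - f (xbar T) ustar)
      + (f (xbar T) ustar - f xs ustar) by rewrite addrA subrK.
  rewrite (le_trans (ler_normD _ _))// (ger0_norm opt0).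
  apply: le_trans (lerD h1 opt1) _.
  rewrite [leLHS]addrC /K [leRHS]mulrDl lerD//.
  by rewrite [leRHS]mulrDl lerD.
by apply/eqoP => eps eps0; near=> T; rewrite normr0 mulr_ge0// ltW.
Unshelve. all: by end_near. Qed.
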